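(* For an integer $n\ge 1$, let $\mathcal{P}_n$ denote the set of real algebraic polynomials of degree at most $n$, and let $$\mathcal{H}_n=\Big\{f:\ \int_0^x f(t)\,dt=e^{-x/2}p(x)\ \text{for all } x\ge 0,\ \text{for some } p\in\mathcal{P}_n \text{ with } p(0)=0\Big\}.$$ Let $c_n$ be the smallest constant such that $$\int_0^\infty\Big(\frac{1}{x}\int_0^x f(t)\,dt\Big)^2dx\le c_n\int_0^\infty f^2(x)\,dx\qquad\text{for all } f\in\mathcal{H}_n.$$ Then $$4\Big(1-\frac{2}{\ln\frac{n+1}{2}+2}\Big)\le c_n\le 4\Big(1-\frac{8}{(\ln\frac{n+1}{2}+4)^2}\Big).$$ *)

(* Defs.v *)
From HB Require Import structures.
From mathcomp Require Import all_boot all_order all_algebra.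
From mathcomp Require Import all_classical all_reals all_analysis.
Set Implicit Arguments. Unset Strict Implicit. Unset Printing Implicit Defensive.
Import Order.TTheory GRing.Theory Num.Theory.
Local Open Scope classical_set_scope.
Local Open Scope ring_scope.

Definition primitive (R : realType) (f : R -> R) (x : R) : R :=
  fine (\int[@lebesgue_measure R]_(t in `[0%R, x]) (f t)%:E)%E.

Definition Hclass (R : realType) (n : nat) (f : R -> R) : Prop :=
  (forall x : R, 0 <= x ->
     (@lebesgue_measure R).-integrable `[0%R, x] (EFin \o f)) /\
  exists p : {poly R}, (size p <= n.+1)%N /\ p.[0] = 0 /\
    forall x : R, 0 <= x ->
      (\int[@lebesgue_measure R]_(t in `[0%R, x]) (f t)%:E)%E
        = (expR (- x / 2) * p.[x])%:E.

Definition hardy_lhs (R : realType) (f : R -> R) : \bar R :=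
  (\int[@lebesgue_measure R]_(x in `]0%R, +oo[) ((x^-1 * primitive f x) ^+ 2)%:E)%E.

Definition l2_sq (R : realType) (f : R -> R) : \bar R :=
  (\int[@lebesgue_measure R]_(x in `[0%R, +oo[) ((f x) ^+ 2)%:E)%E.

Definition admissible (R : realType) (n : nat) (c : R) : Prop :=
  forall f : R -> R, Hclass n f -> (hardy_lhs f <= c%:E * l2_sq f)%E.

(* Main.v *)
Require Import Defs.
From HB Require Import structures.
From mathcomp Require Import all_boot all_order all_algebra.
From mathcomp Require Import ring lra zify.
From mathcomp Require Import all_classical all_reals all_analysis.
From mathcomp Require Import measurable_realfun.
Set Implicit Arguments. Unset Strict Implicit. Unset Printing Implicit Defensive.
Import Order.TTheory GRing.Theory Num.Theory.
Import numFieldNormedType.Exports.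
Local Open Scope ring_scope.

(** Write the primitive of [f] as [exp(-x/2) x q(x)] and let [a_k] be the
    coefficients of [q] in the Laguerre basis, which is orthonormal for the
    weight [exp(-x)].  Then [f = exp(-x/2) (q + B q) / 2] almost everywhere, where
    [B q = q + 2xq' - xq] is skew-adjoint with
    [B L_k = (k+1) L_(k+1) - k L_(k-1)], so the inequality reads
    [|a|^2 <= c/4 (|a|^2 + |B a|^2)].  The operator [B] couples only indices of
    opposite parity, and on each parity class it is a first-order difference
    operator.  The squared Hilbert-Schmidt norm of its inverse is at most
    [l^2/8 + l + 1], with [l = ln N] and [N = floor ((n+1)/2)], which gives the
    upper bound; the lower bound comes from the sequence that is solved
    explicitly from [(B a)_(2k+1) = w_k], [w_k] the Wallis products. *)

(** * A discrete Hardy inequality *)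

Lemma sqr_sum_mul_le (R : realFieldType) (x y : nat -> R) m n :
  (\sum_(m <= i < n) x i * y i) ^+ 2 <=
  (\sum_(m <= i < n) x i ^+ 2) * (\sum_(m <= i < n) y i ^+ 2).
Proof.
elim: n => [|n IH]; first by rewrite !big_geq// expr0n mulr0.
have [mn|nm] := leqP m n; last by rewrite !big_geq// expr0n mulr0.
rewrite !big_nat_recr //=.
set A := \sum_(_ <= _ < _) _ in IH *; set B := \sum_(_ <= _ < _) x _ ^+ 2 in IH *.
set C := \sum_(_ <= _ < _) _ in IH *.
have B0 : 0 <= B by apply: sumr_ge0 => i _; exact: sqr_ge0.
have C0 : 0 <= C by apply: sumr_ge0 => i _; exact: sqr_ge0.
(* The cross term is compared after squaring: [A ^+ 2 <= B * C] by induction, then the inequality of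
   arithmetic and geometric means. *)
have h : 2 * A * (x n * y n) <= B * y n ^+ 2 + x n ^+ 2 * C.
  have h0 : 0 <= B * y n ^+ 2 + x n ^+ 2 * C.
    by rewrite addr_ge0 // mulr_ge0 // sqr_ge0.
  apply: le_trans (ler_norm _) _.
  rewrite -(@ler_pXn2r _ 2) ?nnegrE //.
  rewrite -normrX ger0_norm ?sqr_ge0 //.
  have -> : (2 * A * (x n * y n)) ^+ 2 = 4 * A ^+ 2 * (x n ^+ 2 * y n ^+ 2) by ring.
  apply: (@le_trans _ _ (4 * (B * C) * (x n ^+ 2 * y n ^+ 2))).
    apply: ler_wpM2r; first by rewrite mulr_ge0 // sqr_ge0.
    by rewrite ler_pM2l.
  have := sqr_ge0 (B * y n ^+ 2 - x n ^+ 2 * C); nra.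
nra.
Qed.

Lemma sum_triangle (R : comNzRingType) (g h : nat -> R) n :
  \sum_(0 <= m < n) g m * (\sum_(m <= j < n) h j) =
  \sum_(0 <= j < n) h j * (\sum_(0 <= m < j.+1) g m).
Proof.
elim: n => [|n IH]; first by rewrite !big_geq.
rewrite [RHS]big_nat_recr //= -IH big_nat_recr //= big_nat1.
rewrite [X in h n * X]big_nat_recr //= mulrDr addrA; congr (_ + _); last by rewrite mulrC.
rewrite mulr_sumr -big_split /=; apply: eq_big_nat => m /andP[_ mn].
by rewrite big_nat_recr ?(ltnW mn) //= mulrDr [h n * _]mulrC.
Qed.

(* The solution of [alpha m * w m = beta m * w m.+1]; writing [b = w * u]
   turns [alpha m * b m - beta m * b m.+1] into a multiple of [u m - u m.+1]. *)
Definition hweight (R : fieldType) (alpha beta : nat -> R) (m : nat) : R :=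
  \prod_(0 <= i < m) (alpha i / beta i).

Lemma hweight_gt0 (R : realFieldType) (alpha beta : nat -> R) m :
  (forall k, 0 < alpha k) -> (forall k, 0 < beta k) -> 0 < hweight alpha beta m.
Proof. by move=> a0 b0; apply: prodr_gt0 => i _; rewrite divr_gt0. Qed.

Lemma hweightS (R : fieldType) (alpha beta : nat -> R) m : beta m != 0 ->
  beta m * hweight alpha beta m.+1 = alpha m * hweight alpha beta m.
Proof. by move=> b0; rewrite /hweight big_nat_recr //=; field. Qed.

(* Cauchy-Schwarz on [u m = \sum_(m <= j) (u j - u j.+1)]: the constant is the
   squared Hilbert-Schmidt norm of the inverse operator. *)
Lemma hardy_hilbert_schmidt (R : realFieldType) (alpha beta b : nat -> R) N :
  (forall k, 0 < alpha k) -> (forall k, 0 < beta k) -> b N = 0 ->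
  \sum_(0 <= m < N) b m ^+ 2 <=
  (\sum_(0 <= j < N) (alpha j * hweight alpha beta j) ^- 2 *
     \sum_(0 <= m < j.+1) hweight alpha beta m ^+ 2) *
  \sum_(0 <= m < N) (alpha m * b m - beta m * b m.+1) ^+ 2.
Proof.
move=> a_gt0 b_gt0 bN; set w := hweight alpha beta.
pose e m := alpha m * b m - beta m * b m.+1.
pose h m := (alpha m * w m)^-1.
have w0 m : w m != 0 by rewrite gt_eqF ?hweight_gt0.
have a0 m : alpha m != 0 by rewrite gt_eqF.
have be0 m : beta m != 0 by rewrite gt_eqF.
have bE m : (m <= N)%N -> b m = w m * \sum_(m <= j < N) h j * e j.
  move=> mN.
  (* By the recursion for [w], [h j * e j] is the difference [b j / w j - b j.+1 / w j.+1]. *)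
  have -> : \sum_(m <= j < N) h j * e j = - (b N / w N) - - (b m / w m).
    apply: (@GRing.telescope_sumr_eq R m N (fun j => - (b j / w j))) => // k _.
    have wS : w k.+1 = alpha k * w k / beta k by rewrite /w -hweightS // mulrAC mulfV ?mul1r.
    by rewrite wS /h /e; field; rewrite ?w0 ?a0 ?be0.
  by rewrite bN; field; rewrite ?w0.
have bound m : (m < N)%N ->
    b m ^+ 2 <= w m ^+ 2 * (\sum_(m <= j < N) h j ^+ 2) *
                \sum_(0 <= j < N) e j ^+ 2.
  move=> mN; rewrite bE ?(ltnW mN) // exprMn -mulrA.
  rewrite ler_wpM2l ?sqr_ge0 //; apply: (le_trans (sqr_sum_mul_le _ _ _ _)).
  rewrite ler_wpM2l ?sumr_ge0 // => [i _|]; first exact: sqr_ge0.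
  rewrite [leRHS](big_cat_nat (leq0n m) (ltnW mN)) /= lerDr sumr_ge0 // => i _.
  exact: sqr_ge0.
have := @ler_sum_nat R 0 N (fun m => b m ^+ 2) _ (fun m mN => bound m (proj2 (andP mN))).
move=> /le_trans; apply; rewrite -mulr_suml sum_triangle.
by rewrite le_eqVlt; apply/orP; left; apply/eqP; congr (_ * _);
  apply: eq_bigr => j _; rewrite exprVn.
Qed.

(** * Logarithmic estimate of the Hilbert-Schmidt norm *)

(** With [z = (m + 3/4)^-1], the claim is [m / (m + 1) <= expR (- z)], where
    [expR (- z) >= (1 - z/2)^2]. The shift 3/4 makes the quadratic terms cancel, so that only
    [z^3 / 16] remains. *)
Lemma ln_succ_ge (R : realType) (m : nat) : (0 < m)%N ->
  (m%:R + 3 / 4)^-1 <= ln m.+1%:R - ln m%:R :> R.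
Proof.
move=> m0; have m0' : 0 < m%:R :> R by rewrite ltr0n.
set z : R := (_ + _)^-1.
have z0 : 0 < z by rewrite invr_gt0; lra.
rewrite -ln_div ?posrE ?ltr0n // -[z]expRK ler_ln ?posrE ?expR_gt0 ?divr_gt0 ?ltr0n //.
have mE : m%:R = z^-1 - 3 / 4 :> R by rewrite /z invrK; ring.
rewrite -[expR z]invrK -expRN -[leRHS]invf_div lef_pV2; last 2 first.
- by rewrite posrE expR_gt0.
- by rewrite posrE divr_gt0 ?ltr0n.
have -> : expR (- z) = expR (- z / 2) ^+ 2.
  by rewrite -expRM_natl; congr expR; field.
have h : 1 - z / 2 <= expR (- z / 2) by have := expR_ge1Dx (- z / 2); lra.
have z1 : z < 4 / 3.
  by rewrite invf_plt ?posrE //; lra.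
apply: (@le_trans _ _ ((1 - z / 2) ^+ 2)); last first.
  by rewrite ler_pXn2r ?nnegrE // ?expR_ge0 //; lra.
rewrite -natr1 mE.
have -> : (z^-1 - 3 / 4) / (z^-1 - 3 / 4 + 1) = (1 - 3 / 4 * z) / (1 + z / 4).
  by field; rewrite !gt_eqF //; lra.
rewrite ler_pdivrMr; last by lra.
have : 0 <= z ^+ 3 by rewrite exprn_ge0 // ltW.
by rewrite -subr_ge0 => z3; rewrite -subr_ge0;
  have -> : (1 - z / 2) ^+ 2 * (1 + z / 4) - (1 - 3 / 4 * z) = z ^+ 3 / 16; [field|lra].
Qed.

(** This is [(ln N + 4)^2 / 8 - 1], the source of the square in the upper bound. *)
Definition hardy_bound (R : realType) (N : nat) : R :=
  ln N%:R ^+ 2 / 8 + ln N%:R + 1.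

(** Divided by [w j ^+ 2], the sum at most gets multiplied by the squared ratio and increased by 1
    at each step. The factor [j + 1/4] absorbs the squared ratio, the growth of [ln j] absorbs the
    1. *)
Lemma hweight_sum_le (R : realType) (alpha beta : nat -> R) :
  (forall k, 0 < alpha k) -> (forall k, 0 < beta k) ->
  (forall k, beta k / alpha k <= (2 * k%:R + 2) / (2 * k%:R + 1)) ->
  let w := hweight alpha beta in
  forall j, (0 < j)%N ->
  \sum_(0 <= m < j.+1) w m ^+ 2 <= (j%:R + 1 / 4) * (4 + ln j%:R) * w j ^+ 2.
Proof.
move=> a_gt0 b_gt0 ratio w.
have rec j (c : R) : 0 <= c -> \sum_(0 <= m < j.+1) w m ^+ 2 <= c * w j ^+ 2 ->
    \sum_(0 <= m < j.+2) w m ^+ 2 <=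
    (c * ((2 * j%:R + 2) / (2 * j%:R + 1)) ^+ 2 + 1) * w j.+1 ^+ 2.
  move=> c0 cP; rewrite big_nat_recr //= mulrDl mul1r lerD2r.
  apply: (le_trans cP); rewrite -mulrA ler_wpM2l //.
  have -> : w j = beta j / alpha j * w j.+1.
    have := @hweightS R alpha beta j (lt0r_neq0 (b_gt0 j)); rewrite -/w => wS.
    by rewrite mulrAC wS; field; exact: lt0r_neq0.
  rewrite exprMn ler_wpM2r ?sqr_ge0 // ler_pXn2r
    ?nnegrE ?divr_ge0 ?(ltW (a_gt0 _)) ?(ltW (b_gt0 _)) //;
    by have : 0 <= j%:R :> R by []; lra.
elim=> [//|[|j] IH] _.
  (* At [j = 1] the ratio bound is 2 and the factor is [2 ^+ 2 + 1 = (1 + 1/4) * 4], whence the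
     constant 4. *)
  apply: le_trans (rec 0%N 1 _ _) _ => //.
    by rewrite big_nat1 mul1r.
  by rewrite ln1 ler_wpM2r ?sqr_ge0 //; rewrite mulr0 !add0r divr1 mul1r addr0; lra.
have j0 : 0 < j.+1%:R :> R by rewrite ltr0n.
have l0 : 0 <= ln j.+1%:R :> R by rewrite ln_ge0 // ler1n.
apply: le_trans (rec _ _ _ (IH isT)) _; first by rewrite mulr_ge0; lra.
rewrite ler_wpM2r ?sqr_ge0 //.
have h := @ln_succ_ge R j.+1 isT.
rewrite -[j.+2%:R]natr1 in h *.
set x := j.+1%:R in j0 l0 h *; set l := ln x in l0 h *; set l' := ln _ in h *.
(* After multiplication by [(2x + 1)^2] the two sides differ by exactly 1/4. *)
have h1 : (x + 1 / 4) * ((2 * x + 2) / (2 * x + 1)) ^+ 2 <= x + 1 + 1 / 4.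
  rewrite expr_div_n mulrA ler_pdivrMr; last by rewrite exprn_gt0; lra.
  nra.
have h2 : 1 <= (x + 1 + 1 / 4) * (l' - l).
  have : (x + 3 / 4) * (x + 3 / 4)^-1 = 1 by rewrite mulfV // gt_eqF; lra.
  have : 0 < (x + 3 / 4)^-1 by rewrite invr_gt0; lra.
  set z := _^-1 in h *; nra.
apply: (@le_trans _ _ ((x + 1 + 1/4) * (4 + l) + 1)); last by nra.
rewrite lerD2r mulrAC; apply: ler_wpM2r => //; lra.
Qed.

(** The term of index [j > 0] is at most [(1 + l/4) (l' - l)], where [l = ln j] and
    [l' = ln (j + 1)]. By convexity of [l^2/8 + l] this is at most the increment of [hardy_bound];
    the summand 1 pays for the term of index 0. *)
Lemma hardy_trace_le (R : realType) (alpha beta : nat -> R) :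
  (forall k, 2 * k%:R + 1 <= alpha k) -> (forall k, 0 < beta k) ->
  (forall k, beta k / alpha k <= (2 * k%:R + 2) / (2 * k%:R + 1)) ->
  let w := hweight alpha beta in
  forall N, (0 < N)%N ->
  \sum_(0 <= j < N) (alpha j * w j) ^- 2 * \sum_(0 <= m < j.+1) w m ^+ 2 <=
  hardy_bound R N.
Proof.
move=> a_ge b_gt0 ratio w.
have a_gt0 k : 0 < alpha k.
  by apply: lt_le_trans (a_ge k); have : 0 <= k%:R :> R by []; lra.
have w0 k : w k != 0 by rewrite gt_eqF // hweight_gt0.
elim=> [//|[|j] IH] _.
  rewrite !big_nat1 /hardy_bound ln1 expr0n /= mul0r !add0r.
  have a1 : 1 <= alpha 0%N by have := a_ge 0%N; rewrite mulr0 add0r.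
  have -> : (alpha 0%N * w 0%N) ^- 2 * w 0%N ^+ 2 = (alpha 0%N ^+ 2)^-1.
    by field; rewrite w0 gt_eqF.
  by rewrite invf_le1 ?exprn_gt0 // exprn_ege1.
rewrite big_nat_recr //=; apply: le_trans (lerD (IH isT) (lexx _)) _.
have h := @ln_succ_ge R j.+1 isT.
have j0 : 0 < j.+1%:R :> R by rewrite ltr0n.
have l0 : 0 <= ln j.+1%:R :> R by rewrite ln_ge0 // ler1n.
have := @hweight_sum_le R _ _ a_gt0 b_gt0 ratio j.+1 isT.
have := a_ge j.+1; rewrite -/w /hardy_bound -[j.+2%:R]natr1 in h *.
set s := \sum_(_ <= _ < _) _; set a := alpha _.
set x := j.+1%:R in j0 l0 h *; set l := ln x in l0 h *; set l' := ln _ in h *.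
set v := w _; move=> xa sP.
have v0 : v != 0 by exact: w0.
have a0 : 0 < a by exact: a_gt0.
have : (a * v) ^- 2 * s <= (4 + l) / 4 * (l' - l).
  rewrite mulrC ler_pdivrMr ?exprn_gt0 ?mulr_gt0 ?hweight_gt0 //.
  apply: (le_trans sP); rewrite exprMn [leRHS]mulrA ler_wpM2r ?sqr_ge0 //.
  (* This is [(x + 1/4) (x + 3/4) <= (x + 1/2)^2]. *)
  apply: (@le_trans _ _ ((4 + l) / 4 * (x + 3 / 4)^-1 * (2 * x + 1) ^+ 2)).
    rewrite [_ * (4 + l)]mulrC -[(4 + l) / 4 / _]mulrA -mulrA.
    apply: ler_wpM2l; first lra.
    rewrite mulrAC mulrC ler_pdivlMr; nra.
  apply: ler_pM => //.
  - by rewrite !mulr_ge0 ?sqr_ge0 ?invr_ge0 //; lra.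
  - by rewrite sqr_ge0.
  - by apply: ler_wpM2l => //; lra.
  - by rewrite ler_pXn2r ?nnegrE //; lra.
have := sqr_ge0 (l' - l); set A := _ * s; nra.
Qed.

Lemma discrete_hardy (R : realType) (alpha beta b : nat -> R) N :
  (forall k, 2 * k%:R + 1 <= alpha k) -> (forall k, 0 < beta k) ->
  (forall k, beta k / alpha k <= (2 * k%:R + 2) / (2 * k%:R + 1)) ->
  (0 < N)%N -> b N = 0 ->
  \sum_(0 <= m < N) b m ^+ 2 <=
  hardy_bound R N * \sum_(0 <= m < N) (alpha m * b m - beta m * b m.+1) ^+ 2.
Proof.
move=> a_ge b_gt0 ratio N0 bN.
have a_gt0 k : 0 < alpha k.
  by apply: lt_le_trans (a_ge k); have : 0 <= k%:R :> R by []; lra.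
apply: le_trans (hardy_hilbert_schmidt a_gt0 b_gt0 bN) _.
rewrite ler_wpM2r ?hardy_trace_le // sumr_ge0 // => i _; exact: sqr_ge0.
Qed.

Lemma sum_even_odd (R : nmodType) (f : nat -> R) N :
  \sum_(0 <= k < N.*2) f k =
  \sum_(0 <= m < N) f m.*2 + \sum_(0 <= m < N) f m.*2.+1.
Proof.
elim: N => [|N IH]; first by rewrite !big_geq // addr0.
by rewrite doubleS !big_nat_recr //= IH -addrA addrACA -!addrA.
Qed.

(* The matrix of [q |-> q + 2xq' - xq] in the Laguerre basis. *)
Definition skew_coef (R : pzRingType) (a : nat -> R) (j : nat) : R :=
  j%:R * a j.-1 - j.+1%:R * a j.+1.

(** Even indices give [alpha = 2m + 1], [beta = 2m + 2], the extreme case of [discrete_hardy]; odd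
    indices give [2m + 2], [2m + 3], with a smaller ratio. *)
Lemma skew_coef_bound (R : realType) (a : nat -> R) N : (0 < N)%N ->
  (forall k, (N.*2 <= k)%N -> a k = 0) ->
  \sum_(0 <= k < N.*2) a k ^+ 2 <=
  hardy_bound R N * \sum_(0 <= k < N.*2) skew_coef a k.+1 ^+ 2.
Proof.
have k0 k : 0 <= k%:R :> R by [].
move=> N0 aN; rewrite !sum_even_odd mulrDr lerD //.
- have -> : \sum_(0 <= m < N) skew_coef a m.*2.+1 ^+ 2 = \sum_(0 <= m < N)
      ((2 * m%:R + 1) * a m.*2 - (2 * m%:R + 2) * a m.+1.*2) ^+ 2.
    apply: eq_bigr => m _; rewrite /skew_coef doubleS -!natr1 -muln2 natrM.
    by congr (_ ^+ 2); ring.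
  apply: (discrete_hardy (b := fun m => a m.*2)) => //; last exact: aN.
- have -> : \sum_(0 <= m < N) skew_coef a m.*2.+2 ^+ 2 = \sum_(0 <= m < N)
      ((2 * m%:R + 2) * a m.*2.+1 - (2 * m%:R + 3) * a m.+1.*2.+1) ^+ 2.
    apply: eq_bigr => m _; rewrite /skew_coef doubleS -!natr1 -muln2 natrM.
    by congr (_ ^+ 2); ring.
  apply: (discrete_hardy (b := fun m => a m.*2.+1)) => //; last exact/aN/leqnSn.
  + by move=> k; have := k0 k; lra.
  + move=> k; have := k0 k => kk.
    rewrite ler_pdivrMr; last lra.
    rewrite mulrAC ler_pdivlMr; last lra.
    nra.
Qed.

(** * A test sequence for the lower bound *)

Definition test_weight (R : realType) : nat -> R :=
  hweight (fun k => 2 * k%:R + 1) (fun k => 2 * k%:R + 2).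

(** On even indices this is the solution formula from [hardy_hilbert_schmidt] with right-hand side
    [e j = w j], for which [h j * e j = 1 / (2j + 1)]. *)
Definition test_seq (R : realType) (N k : nat) : R :=
  if odd k then 0
  else test_weight R k./2 * \sum_(k./2 <= j < N) (2 * j%:R + 1)^-1.

Lemma test_seq0 (R : realType) N k : (N.*2 <= k)%N -> test_seq R N k = 0.
Proof.
move=> Nk; rewrite /test_seq; case: ifP => // _.
by rewrite big_geq ?mulr0 // -(doubleK N) half_leq.
Qed.

(** The induction step is [(2k + 1) (2k + 3) <= (2k + 2)^2]. *)
Lemma test_weight_le (R : realType) k :
  test_weight R k ^+ 2 <= (2 * k%:R + 1)^-1.
Proof.
elim: k => [|k IH].
  by rewrite /test_weight /hweight big_geq // expr1n mulr0 add0r invr1.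
have k0 : 0 <= k%:R :> R by [].
rewrite /test_weight /hweight big_nat_recr //= exprMn -/(hweight _ _ k) -/(test_weight R k).
apply: (@le_trans _ _ ((2 * k%:R + 1)^-1 * ((2 * k%:R + 1) / (2 * k%:R + 2)) ^+ 2)).
  by rewrite ler_wpM2r ?sqr_ge0.
rewrite -natr1.
have -> : (2 * k%:R + 1)^-1 * ((2 * k%:R + 1) / (2 * k%:R + 2)) ^+ 2 =
    (2 * k%:R + 1) / (2 * k%:R + 2) ^+ 2 :> R.
  by field; rewrite !gt_eqF //; lra.
rewrite ler_pdivrMr ?exprn_gt0; [|lra..].
rewrite [leRHS]mulrC ler_pdivlMr; [nra|lra].
Qed.

Lemma test_skew_even (R : realType) N k :
  (k < N)%N -> skew_coef (test_seq R N) k.*2.+1 = test_weight R k.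
Proof.
move=> kN; have k0 : 0 <= k%:R :> R by [].
rewrite /skew_coef /test_seq /= odd_double /= doubleK.
rewrite big_ltn // [test_weight R k.+1]/test_weight /hweight big_nat_recr //=.
rewrite -/(hweight _ _ k) -/(test_weight R k) -!natr1 -muln2 natrM.
by field; rewrite !gt_eqF //; lra.
Qed.

Lemma test_skew_odd (R : realType) N k : skew_coef (test_seq R N) k.*2.+2 = 0.
Proof. by rewrite /skew_coef /test_seq /= odd_double /= !mulr0 subr0. Qed.

(** Consecutive odd numbers have ratio [1 + 2y] with [y = 1 / (2N + 1)], and [ln (1 + 2y) <= 2y]. *)
Lemma ln_le_sum_odd_inv (R : realType) N :
  ln (2 * N%:R + 1) / 2 <= \sum_(0 <= j < N) (2 * j%:R + 1)^-1 :> R.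
Proof.
elim: N => [|N IH]; first by rewrite big_geq // mulr0 add0r ln1 mul0r.
have k0 : 0 <= N%:R :> R by [].
rewrite big_nat_recr //=; apply: le_trans (lerD IH (lexx _)).
set y : R := (2 * N%:R + 1)^-1.
have y0 : 0 < y by rewrite invr_gt0; lra.
have -> : 2 * N.+1%:R + 1 = (2 * N%:R + 1) * (1 + 2 * y).
  by rewrite -natr1 /y; field; rewrite gt_eqF //; lra.
rewrite lnM ?posrE; [|lra..].
by have := @le_ln1Dx R (2 * y); lra.
Qed.

(** The first sum is bounded below by its term at [k = 0] alone, whose base is [u0]; the second is
    the sum of the squared weights. *)
Lemma test_seq_ratio (R : realType) N (u0 := \sum_(0 <= j < N) (2 * j%:R + 1)^-1 : R) :
  (0 < N)%N ->
  u0 ^+ 2 <= \sum_(0 <= k < N.*2) test_seq R N k ^+ 2 /\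
  \sum_(0 <= k < N.*2) skew_coef (test_seq R N) k.+1 ^+ 2 <= u0.
Proof.
move=> N0; split; rewrite sum_even_odd.
- rewrite big_ltn // -addrA /test_seq /= [test_weight R 0%N]/test_weight /hweight.
  rewrite big_geq // mul1r -/u0 lerDl addr_ge0 // sumr_ge0 // => i _; exact: sqr_ge0.
- rewrite [X in _ + X]big1 ?addr0 => [|i _]; last by rewrite test_skew_odd expr0n.
  apply: ler_sum_nat => i /andP[_ iN]; rewrite test_skew_even //.
  exact: test_weight_le.
Qed.

(** * Laguerre polynomials *)

(* [expint p] is the integral of [expR (- x) * p.[x]] over the half-line. *)
Definition expint (R : pzSemiRingType) (p : seq R) : R :=
  \sum_(i < size p) p`_i * i`!%:R.

Lemma expint_wide (R : pzSemiRingType) (p : seq R) n : (size p <= n)%N ->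
  expint p = \sum_(i < n) p`_i * i`!%:R.
Proof.
move=> pn; rewrite /expint (big_ord_widen n (fun i => p`_i * i`!%:R)) // big_mkcond.
apply: eq_bigr => i _; case: ltnP => // ip; by rewrite nth_default // mul0r.
Qed.

Lemma expintD (R : nzRingType) (p q : {poly R}) : expint (p + q) = expint p + expint q.
Proof.
pose n := maxn (size p) (size q).
rewrite !(@expint_wide _ _ n) ?leq_maxl ?leq_maxr ?size_polyD // -big_split /=.
by apply: eq_bigr => i _; rewrite coefD mulrDl.
Qed.

Lemma expintZ (R : nzRingType) a (p : {poly R}) : expint (a *: p) = a * expint p.
Proof.
rewrite (@expint_wide _ _ (size p)) ?size_scale_leq // mulr_sumr.
by apply: eq_bigr => i _; rewrite coefZ mulrA.
Qed.

Lemma expintN (R : nzRingType) (p : {poly R}) : expint (- p) = - expint p.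
Proof. by rewrite -scaleN1r expintZ mulN1r. Qed.

Lemma expintB (R : nzRingType) (p q : {poly R}) : expint (p - q) = expint p - expint q.
Proof. by rewrite expintD expintN. Qed.

Lemma expint0 (R : nzRingType) : expint (0 : {poly R}) = 0.
Proof. by rewrite /expint size_poly0 big_ord0. Qed.

Lemma expint_sum (R : nzRingType) (F : nat -> {poly R}) n :
  expint (\sum_(0 <= i < n) F i) = \sum_(0 <= i < n) expint (F i).
Proof.
elim: n => [|n IH]; first by rewrite !big_geq // expint0.
by rewrite !big_nat_recr //= expintD IH.
Qed.

(** Integration by parts against [exp(-x)], in the form [(i + 1) * i! = (i + 1)!]. *)
Lemma expint_deriv (R : nzRingType) (p : {poly R}) : expint p^`() = expint p - p.[0].
Proof.
rewrite horner_coef0 (@expint_wide _ p (size p).+1) // big_ord_recl /= fact0 mulr1 addrC addKr.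
rewrite (@expint_wide _ _ (size p)); last first.
  by have [->|/lt_size_deriv/ltnW//] := eqVneq p 0; rewrite deriv0.
apply: eq_bigr => i _.
by rewrite coef_deriv -[_ *+ i.+1]mulr_natr /bump /= add1n factS natrM mulrA.
Qed.

Definition laguerre (R : unitRingType) (k : nat) : {poly R} :=
  \poly_(i < k.+1) ((-1) ^+ i * 'C(k, i)%:R / i`!%:R).

Lemma coef_laguerre (R : unitRingType) k i :
  (laguerre R k)`_i = (-1) ^+ i * 'C(k, i)%:R / i`!%:R.
Proof.
rewrite coef_poly ltnS; case: leqP => // ki.
by rewrite bin_small // mulr0 mul0r.
Qed.

Lemma laguerre0 (R : unitRingType) : laguerre R 0 = 1.
Proof.
apply/polyP => -[|i]; rewrite coef_laguerre coef1 ?bin0n /= ?mulr0 ?mul0r //.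
by rewrite !mul1r invr1.
Qed.

Lemma laguerre_at0 (R : unitRingType) k : (laguerre R k).[0] = 1.
Proof. by rewrite horner_coef0 coef_laguerre bin0 fact0 !mul1r invr1. Qed.

Lemma fact_neq0 (R : numDomainType) i : i`!%:R != 0 :> R.
Proof. by rewrite pnatr_eq0 -lt0n fact_gt0. Qed.

Lemma laguerre_deriv (R : numFieldType) k :
  (laguerre R k.+1)^`() = (laguerre R k)^`() - laguerre R k.
Proof.
apply/polyP => i; rewrite coefB !coef_deriv.
rewrite -(mulr_natr (laguerre R k.+1)`_i.+1) -(mulr_natr (laguerre R k)`_i.+1).
rewrite !coef_laguerre binS factS natrD natrM exprS.
have : i.+1%:R != 0 :> R by rewrite pnatr_eq0.
move: (fact_neq0 R i); move: i`!%:R i.+1%:R ((-1) ^+ i) => f m s f0 m0.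
by move: 'C(k, i)%:R 'C(k, i.+1)%:R => c d; field; rewrite f0 m0.
Qed.

Lemma laguerre_mulX_deriv (R : numFieldType) k :
  'X * (laguerre R k.+1)^`() = k.+1%:R *: (laguerre R k.+1 - laguerre R k).
Proof.
apply/polyP => -[|i]; rewrite coefZ coefB coefXM /= !coef_laguerre.
  by rewrite !bin0 subrr mulr0.
rewrite coef_deriv coef_laguerre -(mulr_natr (_ / _)).
have h : k.+1%:R * 'C(k, i)%:R = i.+1%:R * 'C(k.+1, i.+1)%:R :> R.
  by rewrite -!natrM (mul_bin_diag k.+1 i).
have -> : k.+1%:R * ((-1) ^+ i.+1 * 'C(k.+1, i.+1)%:R / i.+1`!%:R
    - (-1) ^+ i.+1 * 'C(k, i.+1)%:R / i.+1`!%:R) =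
    (-1) ^+ i.+1 / i.+1`!%:R * (k.+1%:R * 'C(k, i)%:R) :> R.
  rewrite binS natrD; move: k.+1%:R i.+1`!%:R 'C(k, i)%:R 'C(k, i.+1)%:R => m f c d.
  by ring.
by rewrite h; ring.
Qed.

(** * The skew-adjoint operator and Laguerre expansions *)

Definition skew_op (R : nzRingType) (q : {poly R}) : {poly R} :=
  q + 2 *: ('X * q^`()) - 'X * q.

Lemma skew_opD (R : comNzRingType) (p q : {poly R}) :
  skew_op (p + q) = skew_op p + skew_op q.
Proof. by rewrite /skew_op derivD -!mul_polyC; ring. Qed.

Lemma skew_opZ (R : comNzRingType) a (p : {poly R}) : skew_op (a *: p) = a *: skew_op p.
Proof. by rewrite /skew_op derivZ -!mul_polyC; ring. Qed.

Lemma skew_op0 (R : comNzRingType) : skew_op (0 : {poly R}) = 0.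
Proof. by rewrite -(scale0r 0) skew_opZ !scale0r. Qed.

(** Replacing [L_k] by [L_k' - L_(k+1)'] in [x L_k] leaves [L_k + x L_k' + x L_(k+1)'], and
    [laguerre_mulX_deriv] removes both derivatives. *)
Lemma skew_op_laguerre (R : numFieldType) k :
  skew_op (laguerre R k) = k.+1%:R *: laguerre R k.+1 - k%:R *: laguerre R k.-1.
Proof.
have F := laguerre_deriv R k; have E1 := laguerre_mulX_deriv R k.
have E0 : 'X * (laguerre R k)^`() = k%:R *: (laguerre R k - laguerre R k.-1).
  case: k {F E1} => [|k]; last exact: laguerre_mulX_deriv.
  by rewrite laguerre0 derivC mulr0 scale0r.
move: F E1 E0; rewrite /skew_op; set L := laguerre R k.
set L1 := laguerre R k.+1; set L0 := laguerre R k.-1 => F E1 E0.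
have -> : 'X * L = 'X * L^`() - 'X * L1^`() by rewrite F; ring.
rewrite E1 E0 -!mul_polyC -natr1 polyCD; ring.
Qed.

(* [expint_deriv] applied to [x q^2]. *)
Lemma expint_skew (R : comNzRingType) (q : {poly R}) : expint (q * skew_op q) = 0.
Proof.
have -> : q * skew_op q = ('X * q ^+ 2)^`() - 'X * q ^+ 2.
  rewrite derivM derivX deriv_exp /skew_op -mul_polyC /=; ring.
by rewrite expintB expint_deriv hornerM hornerX mul0r subr0 subrr.
Qed.

Lemma expint_energy (R : comNzRingType) (q : {poly R}) :
  expint ((q + skew_op q) ^+ 2) = expint (q ^+ 2) + expint (skew_op q ^+ 2).
Proof. by rewrite sqrrD !expintD expint_skew !addr0. Qed.

(** Summing [laguerre_deriv] gives [L_k' = - (L_0 + ... + L_(k-1))]. *)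
Lemma expint_deriv_laguerre (R : numFieldType) (p : {poly R}) k :
  expint ((laguerre R k)^`() * p) = - \sum_(0 <= i < k) expint (laguerre R i * p).
Proof.
elim: k => [|k IH]; first by rewrite laguerre0 derivC mul0r expint0 big_geq // oppr0.
by rewrite laguerre_deriv mulrBl expintB IH big_nat_recr //= opprD.
Qed.

(** Integrating [(L_j L_k)'] by parts expresses the product through pairs with smaller index sum. By
    induction the value is [1 - [k < j] - [j < k]]. *)
Lemma laguerre_orthonormal (R : numFieldType) j k :
  expint (laguerre R j * laguerre R k) = (j == k)%:R.
Proof.
have [n] := ubnP (j + k); elim: n j k => // n IH j k jkn.
have rec : expint (laguerre R j * laguerre R k) = 1 -
    \sum_(0 <= i < j) expint (laguerre R i * laguerre R k) -
    \sum_(0 <= i < k) expint (laguerre R i * laguerre R j).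
  have := expint_deriv (laguerre R j * laguerre R k).
  rewrite derivM expintD [laguerre R j * _^`()]mulrC !expint_deriv_laguerre.
  rewrite hornerM !laguerre_at0 mulr1 => /eqP.
  by rewrite eq_sym subr_eq addrC addrA => /eqP.
have cnt m l (c : nat -> R) : (forall i, (i < m)%N -> c i = (i == l)%:R) ->
    \sum_(0 <= i < m) c i = (l < m)%:R.
  move=> cE; rewrite (eq_big_nat _ _ (F2 := fun i => (i == l)%:R)) => [|i /andP[_]//].
    elim: m {cE} => [|m IHm]; first by rewrite big_geq.
    rewrite big_nat_recr //= IHm -natrD ltnS; congr (_%:R); case: ltngtP => //.
  exact: cE.
rewrite rec (cnt j k) ?(cnt k j) => [|i ik|i ij]; last 2 first.
- by rewrite IH //; lia.
- by rewrite IH //; lia.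
by case: ltngtP; rewrite ?subr0 ?subrr.
Qed.

Lemma laguerre_span (R : numFieldType) n (q : {poly R}) : (size q <= n)%N ->
  exists2 a : nat -> R, (forall k, (n <= k)%N -> a k = 0) &
    q = \sum_(0 <= k < n) a k *: laguerre R k.
Proof.
elim: n q => [|n IH] q qn.
  exists (fun=> 0) => //; rewrite big_geq //.
  by apply/eqP; rewrite -size_poly_eq0 -leqn0.
pose c := q`_n / (laguerre R n)`_n.
have ln0 : (laguerre R n)`_n != 0.
  by rewrite coef_laguerre binn mulr1 mulf_neq0 ?signr_eq0 ?invr_eq0 ?fact_neq0.
have [|a a0 aE] := IH (q - c *: laguerre R n).
  apply/leq_sizeP => j; rewrite leq_eqVlt => /predU1P[<-|nj].
    by rewrite coefB coefZ /c divfK ?subrr.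
  rewrite coefB coefZ nth_default ?(leq_trans qn) // coef_laguerre bin_small //.
  by rewrite mulr0 mul0r mulr0 subrr.
exists (fun k => if k == n then c else a k).
  move=> k nk; rewrite gtn_eqF // a0 //; exact: ltnW.
rewrite big_nat_recr //= eqxx -[LHS](subrK (c *: laguerre R n)) aE; congr (_ + _).
by apply: eq_big_nat => i /andP[_ /ltn_eqF ->].
Qed.

Lemma expint_parseval (R : numFieldType) n (a : nat -> R) :
  expint ((\sum_(0 <= k < n) a k *: laguerre R k) ^+ 2) = \sum_(0 <= k < n) a k ^+ 2.
Proof.
elim: n => [|n IH]; first by rewrite !big_geq // expr0n /= expint0.
rewrite !big_nat_recr //= sqrrD expintD expintD IH exprZn expintZ expr2.
rewrite laguerre_orthonormal eqxx mulr1 mulr2n expintD.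
suff -> : expint ((\sum_(0 <= k < n) a k *: laguerre R k) * (a n *: laguerre R n)) = 0.
  by rewrite !addr0.
rewrite -scalerAr expintZ mulr_suml expint_sum big_nat big1 ?mulr0 // => i /andP[_ ni].
by rewrite -scalerAl expintZ laguerre_orthonormal ltn_eqF // mulr0.
Qed.

Lemma skew_op_sum (R : numFieldType) n (a : nat -> R) :
  (forall k, (n <= k)%N -> a k = 0) ->
  skew_op (\sum_(0 <= k < n) a k *: laguerre R k) =
  \sum_(0 <= k < n.+1) skew_coef a k *: laguerre R k.
Proof.
move=> an.
have -> : skew_op (\sum_(0 <= k < n) a k *: laguerre R k) =
    \sum_(0 <= k < n) a k *: skew_op (laguerre R k).
  elim: n {an} => [|n IH]; first by rewrite !big_geq // skew_op0.
  by rewrite !big_nat_recr //= skew_opD IH skew_opZ.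
have part m : \sum_(0 <= k < m) a k *: skew_op (laguerre R k) =
    \sum_(0 <= k < m.+1) (k%:R * a k.-1) *: laguerre R k -
    \sum_(0 <= k < m) (k%:R * a k) *: laguerre R k.-1.
  elim: m => [|m IH]; first by rewrite big_nat1 !big_geq // mul0r scale0r subr0.
  rewrite big_nat_recr //= IH [in RHS]big_nat_recr //= [X in _ = _ - X]big_nat_recr //=.
  rewrite skew_op_laguerre scalerBr !scalerA [a m * _]mulrC [a m * _]mulrC.
  by rewrite opprD addrACA.
have shift m : \sum_(0 <= k < m.+1) (k%:R * a k) *: laguerre R k.-1 =
    \sum_(0 <= k < m) (k.+1%:R * a k.+1) *: laguerre R k.
  by rewrite big_nat_recl //= mul0r scale0r add0r.
(* Two zero terms are appended so that, after the shift, both sums can be brought to the range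
   [n.+1]. *)
have -> : \sum_(0 <= k < n) a k *: skew_op (laguerre R k) =
    \sum_(0 <= k < n.+2) a k *: skew_op (laguerre R k).
  by rewrite !big_nat_recr //= !an ?leqnSn // !scale0r !addr0.
rewrite part shift big_nat_recr //= an ?leqnSn // mulr0 scale0r addr0.
rewrite big_nat_recr //= an // mulr0 scale0r addr0 -sumrB.
by apply: eq_bigr => k _; rewrite -scalerBl.
Qed.

Lemma expint_hardy (R : realType) n (q : {poly R}) : (1 <= n)%N -> (size q <= n)%N ->
  expint (q ^+ 2) <= hardy_bound R (uphalf n) * expint (skew_op q ^+ 2).
Proof.
move=> n1 qn; have [|a a0 ->] := @laguerre_span R (uphalf n).*2 q;
  first by apply: leq_trans qn _; lia.
rewrite skew_op_sum // !expint_parseval.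
apply: le_trans (skew_coef_bound _ a0) _; first by lia.
(* The coefficient of index 0 does not occur in [skew_coef_bound]; its square is dropped. *)
apply: ler_wpM2l; last by rewrite [leRHS]big_nat_recl //= lerDr sqr_ge0.
have N0 : (0 < uphalf n)%N by lia.
have : 0 <= ln (uphalf n)%:R :> R by rewrite ln_ge0 // ler1n.
rewrite /hardy_bound; set l := ln _ => l0; have := sqr_ge0 l; lra.
Qed.

Lemma expint_hardy_test (R : realType) n
    (u0 := \sum_(0 <= j < uphalf n) (2 * j%:R + 1)^-1 : R) : (1 <= n)%N ->
  exists q : {poly R}, [/\ (size q <= n)%N, u0 ^+ 2 <= expint (q ^+ 2) &
    expint (skew_op q ^+ 2) <= u0].
Proof.
move=> n1; set N := uphalf n in u0 *.
have N0 : (0 < N)%N by rewrite /N; lia.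
have [h1 h2] := @test_seq_ratio R N N0.
exists (\sum_(0 <= k < N.*2) test_seq R N k *: laguerre R k); split.
(* For odd [n] the sum reaches the index [n] itself, where [test_seq] vanishes by parity. *)
- apply/leq_sizeP => j nj; rewrite coef_sum big_nat big1 // => i /andP[_ iN].
  rewrite coefZ coef_laguerre; case: (boolP (odd i)) => [oi|ei].
    by rewrite /test_seq oi mul0r.
  rewrite bin_small ?mulr0 ?mul0r ?mulr0 //; apply: leq_trans nj.
  by move: iN ei; rewrite /N; lia.
- by rewrite expint_parseval.
- rewrite skew_op_sum ?expint_parseval; last exact: test_seq0.
  by rewrite big_nat_recl //= /skew_coef mul0r /test_seq /= mulr0 subrr expr0n add0r.
Qed.

Local Open Scope classical_set_scope.
Local Open Scope ring_scope.

(** * Integrals of exponential polynomials *)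

(** The rate [c] is [- 2^-1] for primitives and their derivatives, [-1] for squares. *)
Definition exp_poly (R : realType) (c : R) (p : {poly R}) (x : R) : R :=
  expR (c * x) * p.[x].

Lemma is_derive_exp_poly (R : realType) (c : R) (p : {poly R}) (x : R) :
  is_derive x 1 (exp_poly c p) (exp_poly c (p^`() + c *: p) x).
Proof.
have dl : is_derive x 1 (fun y : R => c * y) c.
  have -> : (fun y : R => c * y) = horner (c *: 'X).
    by apply/funext => y; rewrite hornerZ hornerX.
  have := is_derive_poly (c *: 'X) x.
  by rewrite derivZ derivX hornerZ hornerC mulr1.
have de : is_derive x 1 (fun y => expR (c * y)) (expR (c * x) * c).
  exact: (is_derive1_comp (is_derive_expR _) dl).
have := is_deriveM de (is_derive_poly p x).
move=> /is_derive_eq; apply.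
rewrite /exp_poly hornerD hornerZ /GRing.scale /=; ring.
Qed.

Lemma continuous_exp_poly (R : realType) (c : R) (p : {poly R}) :
  continuous (exp_poly c p).
Proof.
move=> x; apply/differentiable_continuous/derivable1_diffP.
by have [] := is_derive_exp_poly c p x.
Qed.

Lemma cvg_exp_poly (R : realType) (p : {poly R}) :
  exp_poly (-1) p x @[x --> +oo] --> 0.
Proof.
(* The factor ['X^k] lets the induction pass from [p] to [p * 'X + c%:P]. *)
suff H k : exp_poly (-1) ('X^k * p) x @[x --> +oo] --> 0.
  by have := H 0%N; rewrite expr0 mul1r.
elim/poly_ind: p k => [|p c IH] k.
  rewrite mulr0 (_ : exp_poly _ _ = cst 0); first exact: cvg_cst.
  by apply/funext => x; rewrite /exp_poly horner0 mulr0.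
have mono : exp_poly (-1) 'X^k x @[x --> (+oo : set_system R)] --> 0.
  apply: (@squeeze_cvgr _ _ _ _ (cst 0) (fun x => k.+1`!%:R * x^-1)).
  - near=> x; have x0 : 0 < x by near: x; apply: nbhs_pinfty_gt; exact: num_real.
    rewrite /exp_poly hornerXn /=; apply/andP; split.
      by rewrite mulr_ge0 ?expR_ge0 ?exprn_ge0 // ltW.
    rewrite mulN1r expRN [leLHS]mulrC ler_pdivrMr ?expR_gt0 // -mulrA.
    have := expR_ge1Dxn k (ltW x0); move=> h.
    have f0 : 0 < k.+1`!%:R :> R by rewrite ltr0n fact_gt0.
    have -> : x ^+ k = k.+1`!%:R * (x^-1 * (x ^+ k.+1 / k.+1`!%:R)).
      by rewrite exprS; field; rewrite !gt_eqF.
    rewrite !ler_pM2l ?invr_gt0 //; apply: le_trans h; by rewrite lerDr.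
  - exact: cvg_cst.
  - rewrite -(mulr0 (k.+1`!%:R)); apply: cvgM; first exact: cvg_cst.
    apply/gtr0_cvgV0; last exact: cvg_id.
    near=> x; near: x; apply: nbhs_pinfty_gt; exact: num_real.
have -> : exp_poly (-1) ('X^k * (p * 'X + c%:P)) =
    (fun x => exp_poly (-1) ('X^(k.+1) * p) x + c * exp_poly (-1) 'X^k x).
  apply/funext => x; rewrite /exp_poly !(hornerM, hornerD, hornerC, hornerX, hornerXn).
  rewrite exprS; set e := expR _; set a := _ ^+ k; set b := p.[x]; ring.
rewrite -(addr0 0) -{2}(mulr0 c); apply: cvgD; first exact: IH.
by apply: cvgM => //; exact: cvg_cst.
Unshelve. all: by end_near. Qed.

(** Here [P = p + p' + p'' + ...]; then [- exp(-x) P] is an antiderivative of [exp(-x) p]. *)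
Lemma poly_resolvent_deriv (R : nzRingType) (p : {poly R}) :
  exists P : {poly R}, P - P^`() = p.
Proof.
have [n] := ubnP (size p); elim: n p => // n IH p pn.
have [->|p0] := eqVneq p 0; first by exists 0; rewrite deriv0 subrr.
have [|P PE] := IH p^`().
  by apply: leq_trans (lt_size_deriv p0) _; rewrite -ltnS.
by exists (p + P); rewrite derivD opprD addrACA PE subrK.
Qed.

Lemma integral_exp_poly (R : realType) (p : {poly R}) :
  (forall x, 0 <= x -> 0 <= p.[x]) ->
  (\int[@lebesgue_measure R]_(x in `[0%R, +oo[) (exp_poly (-1) p x)%:E)%E =
  (expint p)%:E.
Proof.
move=> p0; have [P PE] := poly_resolvent_deriv p.
have dF (x : R) : is_derive x 1 (exp_poly (-1) (- P)) (exp_poly (-1) p x).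
  have := is_derive_exp_poly (-1) (- P) x.
  by rewrite derivN scalerN scaleN1r opprK addrC PE.
have -> : expint p = P.[0].
  by rewrite -PE expintB expint_deriv opprB addrC subrK.
rewrite (ge0_continuous_FTC2y (F := exp_poly (-1) (- P)) (l := 0)).
- by rewrite /exp_poly mulr0 expR0 mul1r hornerN sub0e -EFinN opprK.
- by move=> x x0; rewrite mulr_ge0 ?expR_ge0 // p0.
- exact/continuous_subspaceT/continuous_exp_poly.
- exact: cvg_exp_poly.
- by move=> x _; have [] := dF x.
- exact/cvg_at_right_filter/continuous_exp_poly.
- by move=> x _; rewrite derive1E; have [_ ->] := dF x.
Qed.

(** * From functions of the class to polynomials *)

(** Lebesgue differentiation of the truncation of [f] to [[0, n]]; countably many null sets are then
    united. *)
Lemma ae_eq_deriv_primitive (R : realType) (f F F' : R -> R) :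
  (forall x : R, 0 <= x -> (@lebesgue_measure R).-integrable `[0%R, x] (EFin \o f)) ->
  (forall x : R, 0 <= x ->
    (\int[@lebesgue_measure R]_(t in `[0%R, x]) (f t)%:E)%E = (F x)%:E) ->
  (forall x : R, 0 < x -> is_derive x 1 F (F' x)) ->
  {ae @lebesgue_measure R, forall x : R, 0 < x -> f x = F' x}.
Proof.
move=> intf fF dF.
suff H n : {ae @lebesgue_measure R, forall x : R, 0 < x < n%:R -> f x = F' x}.
  have /ae_foralln := H; apply: filterS => x Hx x0.
  apply: (Hx (Num.truncn x).+1); rewrite x0 /=; exact: Num.Theory.truncnS_gt.
pose g := f \_ `[0%R, n%:R].
have intg : (@lebesgue_measure R).-integrable setT (EFin \o g).
  by rewrite /g -restrict_EFin -integrable_mkcond //; exact: intf.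
have locg : locally_integrable setT g by apply: integrable_locally => //; exact: intf.
have intgy y : (@lebesgue_measure R).-integrable
    [set` Interval (BLeft 0) (BRight y)] (EFin \o g).
  by apply: integrableS intg.
have := FTC1 intgy locg.
apply: filterS; first exact: (ae_filter_ringOfSetsType lebesgue_measure).
move=> x Hx /andP[x0 xn].
have [|_] := Hx; first by rewrite lte_fin.
rewrite {2}/g patchE mem_set; last by rewrite /= in_itv /= !ltW.
move=> <-; rewrite derive1E; have [_ <-] := dF x x0.
apply: near_eq_derive; near=> y.
have y0 : 0 < y by near: y; exact: lt_nbhsr.
have yn : y < n%:R by near: y; exact: lt_nbhsl.
have /(congr1 fine) /= <- := fF y (ltW y0).
rewrite /Rintegral; congr fine; apply: eq_integral => z;
  rewrite inE /= in_itv /= => /andP[z0 zy].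
by rewrite /g patchE mem_set //= in_itv /= z0 (le_trans zy) // ltW.
Unshelve. all: by end_near. Qed.

Lemma exp_poly_sqr (R : realType) (p : {poly R}) x :
  exp_poly (- 2^-1) p x ^+ 2 = exp_poly (-1) (p ^+ 2) x.
Proof.
by rewrite /exp_poly exprMn horner_exp -expRM_natl; congr (expR _ * _); field.
Qed.

Lemma measurable_halfline (R : realType) (f : R -> R) :
  (forall x : R, 0 <= x -> (@lebesgue_measure R).-integrable `[0%R, x] (EFin \o f)) ->
  measurable_fun `[(0 : R), +oo[ f.
Proof.
move=> intf.
have -> : `[0%R, +oo[%classic = \bigcup_n `[0%R, n%:R]%classic :> set R.
  apply/seteqP; split => x /=; rewrite in_itv /= ?andbT.
    move=> x0; exists (Num.truncn x).+1 => //=; rewrite in_itv /= x0 /=; exact/ltW/truncnS_gt.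
  by move=> [n _]; rewrite /= in_itv /= => /andP[].
apply/measurable_fun_bigcup => // n.
by have /measurable_int /measurable_EFinP := intf n%:R (ler0n _ _).
Qed.

Lemma l2_sq_exp_poly (R : realType) (f : R -> R) (p : {poly R}) :
  (forall x : R, 0 <= x -> (@lebesgue_measure R).-integrable `[0%R, x] (EFin \o f)) ->
  (forall x : R, 0 <= x ->
    (\int[@lebesgue_measure R]_(t in `[0%R, x]) (f t)%:E)%E =
      (exp_poly (- 2^-1) p x)%:E) ->
  l2_sq f = (expint ((p^`() + (- 2^-1) *: p) ^+ 2))%:E.
Proof.
move=> intf fp; set r := p^`() + _.
rewrite -integral_exp_poly; last by move=> x _; rewrite horner_exp sqr_ge0.
have mr : measurable_fun `[(0 : R), +oo[ (exp_poly (-1) (r ^+ 2)).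
  by apply: measurable_funTS; apply: continuous_measurable_fun; exact: continuous_exp_poly.
have mf := measurable_halfline intf.
have mf2 : measurable_fun `[(0 : R), +oo[ (fun x => (f x) ^+ 2).
  exact: measurable_funX.
have sub : (`]0%R, +oo[ `<=` (`[0%R, +oo[ : set R))%classic.
  by apply: subset_itvr; rewrite bnd_simp.
(* The endpoint 0 is removed because the almost everywhere identity concerns [0 < x]. *)
rewrite /l2_sq -!integral_itv_obnd_cbnd; last 2 first.
- by apply/measurable_EFinP; exact: measurable_funS mr.
- by apply/measurable_EFinP; exact: measurable_funS mf2.
apply: ge0_ae_eq_integral => //.
- by apply/measurable_EFinP; exact: measurable_funS mf2.
- by apply/measurable_EFinP; exact: measurable_funS mr.
- by move=> x _; rewrite lee_fin sqr_ge0.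
- by move=> x _; rewrite lee_fin -exp_poly_sqr sqr_ge0.
have := ae_eq_deriv_primitive intf fp (fun x _ => is_derive_exp_poly _ p x).
apply: filterS; first exact: (ae_filter_ringOfSetsType lebesgue_measure).
move=> x Hx; rewrite /= in_itv /= andbT => x0; by rewrite Hx // exp_poly_sqr.
Qed.

Lemma hardy_lhs_exp_poly (R : realType) (f : R -> R) (q : {poly R}) :
  (forall x : R, 0 <= x ->
    (\int[@lebesgue_measure R]_(t in `[0%R, x]) (f t)%:E)%E =
      (exp_poly (- 2^-1) (q * 'X) x)%:E) ->
  hardy_lhs f = (expint (q ^+ 2))%:E.
Proof.
move=> fq; rewrite -integral_exp_poly; last by move=> x _; rewrite horner_exp sqr_ge0.
rewrite -integral_itv_obnd_cbnd; last first.
  apply/measurable_EFinP; apply: measurable_funTS.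
  by apply: continuous_measurable_fun; exact: continuous_exp_poly.
apply: eq_integral => x; rewrite inE /= in_itv /= andbT => x0; congr (_%:E).
rewrite /primitive fq ?ltW //= -exp_poly_sqr; congr (_ ^+ 2).
by rewrite /exp_poly hornerM hornerX; field; rewrite gt_eqF.
Qed.

(** Provides the members of [Hclass] that test the lower bound. *)
Lemma integral_deriv_exp_poly (R : realType) (c : R) (p : {poly R}) (x : R) :
  p.[0] = 0 -> 0 <= x ->
  (\int[@lebesgue_measure R]_(t in `[0%R, x]) (exp_poly c (p^`() + c *: p) t)%:E)%E =
    (exp_poly c p x)%:E.
Proof.
move=> p0; rewrite le_eqVlt => /predU1P[<-|x0].
  by rewrite set_itv1 integral_set1 /exp_poly p0 mulr0.
rewrite (@continuous_FTC2 _ _ (exp_poly c p)) //.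
- by rewrite /exp_poly p0 mulr0 sube0.
- exact/continuous_subspaceT/continuous_exp_poly.
- split.
  + by move=> y _; have [] := is_derive_exp_poly c p y.
  + exact/cvg_at_right_filter/continuous_exp_poly.
  + exact/cvg_at_left_filter/continuous_exp_poly.
- by move=> y _; rewrite derive1E; have [_ ->] := is_derive_exp_poly c p y.
Qed.

Lemma integrable_exp_poly (R : realType) (c : R) (p : {poly R}) (x : R) :
  (@lebesgue_measure R).-integrable `[0%R, x] (EFin \o exp_poly c p).
Proof.
apply: continuous_compact_integrable; first exact: segment_compact.
exact/continuous_subspaceT/continuous_exp_poly.
Qed.

(** The polynomial [p' - p/2] is half of [q + skew_op q], and [expint_energy] splits the square. *)
Lemma expint_l2 (R : realType) (q : {poly R}) (p := q * 'X) :
  expint ((p^`() + (- 2^-1) *: p) ^+ 2) =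
  (expint (q ^+ 2) + expint (skew_op q ^+ 2)) / 4.
Proof.
set r := p^`() + _.
have h : q + skew_op q = 2 *: r.
  rewrite /r scalerDr scalerA mulrN mulfV ?pnatr_eq0 // scaleN1r /p /skew_op.
  by rewrite derivM derivX -!mul_polyC; ring.
have := expint_energy q; rewrite h exprZn expintZ => <-.
by rewrite mulrAC -natrX mulfV ?mul1r // pnatr_eq0.
Qed.

Lemma expint_sqr_ge0 (R : realType) (p : {poly R}) : 0 <= expint (p ^+ 2).
Proof.
rewrite -lee_fin -integral_exp_poly => [|x _]; last by rewrite horner_exp sqr_ge0.
by apply: integral_ge0 => x _; rewrite lee_fin -exp_poly_sqr sqr_ge0.
Qed.

Lemma Hclass_integrals (R : realType) n (f : R -> R) : Hclass n f ->
  exists q : {poly R}, [/\ (size q <= n)%N, hardy_lhs f = (expint (q ^+ 2))%:E &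
    l2_sq f = ((expint (q ^+ 2) + expint (skew_op q ^+ 2)) / 4)%:E].
Proof.
move=> [intf [p [pn [p0 fp]]]].
have /factor_theorem[q pq] : root p 0 by apply/eqP.
rewrite polyC0 subr0 in pq.
have fq x : 0 <= x ->
    (\int[@lebesgue_measure R]_(t in `[0%R, x]) (f t)%:E)%E =
      (exp_poly (- 2^-1) (q * 'X) x)%:E.
  move=> x0; rewrite fp // pq /exp_poly; congr (expR _ * _)%:E; ring.
exists q; split; last by rewrite (l2_sq_exp_poly intf fq) expint_l2.
- have [->|q0] := eqVneq q 0; first by rewrite size_poly0.
  by move: pn; rewrite pq size_mulX.
- exact: hardy_lhs_exp_poly.
Qed.

(* c_n = least admissible constant; we state: the upper bound is admissible,
   and every admissible constant is >= the lower bound. *)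
Theorem theorem1p2 (R : realType) (n : nat) (hn : (1 <= n)%N) :
  admissible n (4 * (1 - 8 / (ln (n.+1%:R / 2) + 4) ^+ 2) : R) /\
  (forall c : R, admissible n c -> 4 * (1 - 2 / (ln (n.+1%:R / 2) + 2)) <= c).
Proof.
have n2 : 2 <= n.+1%:R :> R by rewrite (ler_nat R 2).
set L := ln (n.+1%:R / 2).
have L0 : 0 <= L by rewrite ln_ge0 // ler_pdivlMr // mul1r.
set N := uphalf n.
have N0 : (0 < N)%N by rewrite /N; lia.
split=> [f /Hclass_integrals[q [qn -> ->]]|c adm].
  rewrite -EFinM lee_fin.
  have := @expint_hardy R n q hn qn; have := expint_sqr_ge0 (skew_op q).
  set a := expint (q ^+ 2); set b := expint (skew_op q ^+ 2) => b0 ab.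
  have NL : ln N%:R <= L.
    rewrite ler_ln ?posrE ?ltr0n // ?divr_gt0 //.
    rewrite ler_pdivlMr // -natrM ler_nat /N; lia.
  have l0 : 0 <= ln N%:R :> R by rewrite ln_ge0 // ler1n.
  have {}ab : a <= (L ^+ 2 / 8 + L + 1) * b.
    apply: (le_trans ab); rewrite ler_wpM2r // /hardy_bound -/N; nra.
  have L4 : 0 < (L + 4) ^+ 2 by rewrite exprn_gt0 //; lra.
  (* With [K = L^2/8 + L + 1] one has [(L + 4)^2 - 8 = 8 K], so the goal amounts to [a <= K * b]. *)
  have -> : 4 * (1 - 8 / (L + 4) ^+ 2) * ((a + b) / 4) =
      (((L + 4) ^+ 2 - 8) * (a + b)) / (L + 4) ^+ 2.
    by field; rewrite gt_eqF //; lra.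
  by rewrite ler_pdivlMr //; nra.
have [q []] := @expint_hardy_test R n hn; rewrite -/N.
set u0 := \sum_(_ <= _ < _) _ => qn au bu.
have uL : L <= 2 * u0.
  have := ln_le_sum_odd_inv R N; rewrite -/u0.
  have : L <= ln (2 * N%:R + 1).
    rewrite ler_ln ?posrE; [|by rewrite divr_gt0|by rewrite ltr_wpDl // mulr_ge0].
    rewrite ler_pdivrMr // -natrM natr1 -natrM ler_nat /N; lia.
  lra.
have u00 : 0 < u0.
  rewrite /u0 big_ltn // mulr0 add0r invr1 ltr_pwDl //.
  by apply: sumr_ge0 => i _; rewrite invr_ge0 addr_ge0 // mulr_ge0.
have pn : (size (q * 'X)%R <= n.+1)%N.
  have [->|q0] := eqVneq q 0; first by rewrite mul0r size_poly0.
  by rewrite size_mulX.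
have pz : (q * 'X).[0] = 0 by rewrite hornerM hornerX mulr0.
have prim x : 0 <= x -> _ := @integral_deriv_exp_poly R (- 2^-1) _ x pz.
have int x : 0 <= x -> _ := fun=> @integrable_exp_poly R (- 2^-1)
  ((q * 'X)^`() + (- 2^-1) *: (q * 'X)) x.
(* The test function is the derivative of [exp_poly (- 2^-1) (q * 'X)]; the hole, its primitive in
   the form required by [Hclass], is filled when [h] is applied. *)
have := adm _ (conj int (ex_intro _ _ (conj pn (conj pz _)))).
rewrite (hardy_lhs_exp_poly prim) (l2_sq_exp_poly int prim) expint_l2.
move: au bu; have := expint_sqr_ge0 (skew_op q).
set a := expint (q ^+ 2); set b := expint (skew_op q ^+ 2) => b0 au bu /(_ _) h.
have {}h : a <= c * ((a + b) / 4).
  rewrite -lee_fin; apply: h => x x0; rewrite prim // /exp_poly.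
  by congr (expR _ * _)%:E; ring.
have a0 : 0 < a by apply: lt_le_trans au; rewrite exprn_gt0.
(* From [b <= u0] and [u0 ^+ 2 <= a] follows [b <= a / u0]. *)
have aub : a + b <= a * (u0 + 1) / u0.
  rewrite ler_pdivlMr //; nra.
have c0 : 4 * a <= c * (a + b) by lra.
have -> : 4 * (1 - 2 / (L + 2)) = 4 * L / (L + 2).
  by field; rewrite gt_eqF //; lra.
rewrite ler_pdivrMr; last by lra.
rewrite -(ler_pM2r (_ : 0 < a + b)); last by lra.
(* What remains is [L * b <= 2 * a], from [L <= 2 * u0] and [u0 * b <= a]. *)
apply: (@le_trans _ _ (4 * a * (L + 2))); last by nra.
have : u0 * (a + b) <= a * (u0 + 1) by nra.
nra.
Qed.
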